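(* Let $X\in\mathbb{R}^{m\times n}$ have $\mathrm{rank}(X)=n$, and let $k$ be a fixed integer with $0<k<n$. Let $X_k^*\in\mathbb{R}^{m\times k}$ be a column submatrix of $X$ that maximizes $\log\mathrm{vol}(B)$ among all column submatrices $B\in\mathbb{R}^{m\times k}$ of $X$. Then the Gu–Eisenstat QR column selection algorithm with relaxation factor $\eta>1$ is a 1-interchange algorithm for the log-volume with additive relaxation factor $\theta_a=\log\eta$, and its output matrix $X_k\equiv X_{\mathcal{S}}$ satisfies $$0\le\log\mathrm{vol}(X_k^* )-\log\mathrm{vol}(X_k)\le\frac{k-1}{2k-1}\log\mathrm{vol}\bigl(X_k^*/\sigma_n(X)\bigr)+\frac{k^2}{2k-1}\log(\eta),$$ where $\frac{k-1}{2k-1}<\frac12$ and $\frac{k^2}{2k-1}\le k$.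
   Context: $\sigma_1(X)\ge\cdots\ge\sigma_n(X)$ are the singular values of $X$. For $\mathcal{S}\subset\{1,\ldots,n\}$, $X_{\mathcal{S}}$ is the submatrix of $X$ consisting of the columns indexed by $\mathcal{S}$. $\mathrm{vol}(B)=\sqrt{\det(B^TB)}$, the product of the singular values, for a matrix $B$ with full column rank; a matrix with linearly dependent columns has volume $0$. Gu–Eisenstat QR column selection. Input: $X\in\mathbb{R}^{m\times n}$, an integer $0<k\le\mathrm{rank}(X)$, a relaxation factor $\eta\ge1$. Start with any $\mathcal{S}\subset\{1,\ldots,n\}$ with $|\mathcal{S}|=k$ and $\mathrm{rank}(X_{\mathcal{S}})=k$. As long as there are $i\in\mathcal{S}$ and $j\in\{1,\ldots,n\}-\mathcal{S}$ such that $\mathcal{T}=(\mathcal{S}-\{i\})\cup\{j\}$ satisfies $\mathrm{vol}(X_{\mathcal{T}})>\eta\,\mathrm{vol}(X_{\mathcal{S}})$, replace $\mathcal{S}$ by such a $\mathcal{T}$. When no such swap exists, output the $m\times k$ column submatrix $X_{\mathcal{S}}$. 1-interchange algorithm with additive relaxation factor $\theta_a\ge0$ for a set function $f$ on $\{1,\ldots,n\}$: start with a $k$-element set $\mathcal{S}$; while there are $x\in\mathcal{S}$ and $y\notin\mathcal{S}$ with $f((\mathcal{S}-\{x\})\cup\{y\})>f(\mathcal{S})+\theta_a$, replace $\mathcal{S}$ by $(\mathcal{S}-\{x\})\cup\{y\}$; output $\mathcal{S}$ when no such pair exists. Here $f(\mathcal{S})=\log\mathrm{vol}(X_{\mathcal{S}})$.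 *)

(* Defs.v *)
From HB Require Import structures.
From mathcomp Require Export all_boot all_order all_algebra.
From mathcomp Require Export reals exp.
From mathcomp Require Export polyrcf.

Set Implicit Arguments.
Unset Strict Implicit.
Unset Printing Implicit Defensive.

Import Order.TTheory GRing.Theory Num.Theory.

Local Open Scope ring_scope.

(* The real eigenvalues of [A], each repeated according to its algebraic
   multiplicity. For symmetric [A] these are all [n] eigenvalues. *)
Definition eigenvalues (R : rcfType) (n : nat) (A : 'M[R]_n) : seq R :=
  flatten [seq nseq (mup a (char_poly A)) a | a <- rootsR (char_poly A)].

Definition singular_values (R : rcfType) (m n : nat) (X : 'M[R]_(m, n)) :
    seq R :=
  sort (fun x y => y <= x) [seq Num.sqrt a | a <- eigenvalues (X^T *m X)].

(* Numbered from 1: [sigma X 1 >= ... >= sigma X n]. *)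
Definition sigma (R : rcfType) (m n : nat) (X : 'M[R]_(m, n)) (i : nat) : R :=
  (singular_values X)`_i.-1.

Definition vol (R : rcfType) (m p : nat) (B : 'M[R]_(m, p)) : R :=
  Num.sqrt (\det (B^T *m B)).

(* [ln] is total with [ln 0 = 0], so this is the log-volume only for [B] of
   full column rank (otherwise it should be -oo). *)
Definition log_vol (R : realType) (m p : nat) (B : 'M[R]_(m, p)) : R :=
  ln (vol B).

Definition columns (R : Type) (m n : nat) (X : 'M[R]_(m, n)) (S : {set 'I_n}) :
    'M[R]_(m, #|S|) :=
  colsub (fun i : 'I_#|S| => enum_val i) X.

(* [B = columns X S]; the cast identifies the widths [#|S|] and [k]. *)
Definition is_columns (R : Type) (m n k : nat) (X : 'M[R]_(m, n))
    (S : {set 'I_n}) (B : 'M[R]_(m, k)) : Prop :=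
  exists e : #|S| = k, B = castmx (erefl m, e) (columns X S).

Definition column_submatrix (R : Type) (m n k : nat) (X : 'M[R]_(m, n))
    (B : 'M[R]_(m, k)) : Prop :=
  exists S : {set 'I_n}, is_columns X S B.

Definition max_log_vol (R : realType) (m n k : nat) (X : 'M[R]_(m, n))
    (Xstar : 'M[R]_(m, k)) : Prop :=
  column_submatrix X Xstar /\
  forall B : 'M[R]_(m, k), column_submatrix X B -> log_vol B <= log_vol Xstar.

(* A nondeterministic iteration on a state of type [T]; it stops exactly at the
   states that have no successor. *)
Record algorithm (T : Type) := Algorithm {
  start : T -> Prop;
  step : T -> T -> Prop
}.

Inductive reachable (T : Type) (A : algorithm T) : T -> Prop :=
| reachable_start s : start A s -> reachable A s
| reachable_step s t : reachable A s -> step A s t -> reachable A t.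

Definition output (T : Type) (A : algorithm T) (s : T) : Prop :=
  reachable A s /\ forall t, ~ step A s t.

Definition swap (I : finType) (S T : {set I}) : Prop :=
  exists i j : I, [/\ i \in S, j \notin S & T = j |: (S :\ i)].

Definition gu_eisenstat (R : realType) (m n : nat) (X : 'M[R]_(m, n)) (k : nat)
    (eta : R) : algorithm {set 'I_n} :=
  Algorithm
    (fun S : {set 'I_n} => #|S| = k /\ \rank (columns X S) = k)
    (fun S T : {set 'I_n} => swap S T /\ eta * vol (columns X S) < vol (columns X T)).

Definition gu_eisenstat_output (R : realType) (m n k : nat) (X : 'M[R]_(m, n))
    (eta : R) (Xk : 'M[R]_(m, k)) : Prop :=
  exists2 S : {set 'I_n}, output (gu_eisenstat X k eta) S & is_columns X S Xk.

Definition is_one_interchange (R : realType) (n : nat)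
    (A : algorithm {set 'I_n}) (f : {set 'I_n} -> R) (k : nat) (theta : R) :
    Prop :=
  [/\ 0 <= theta,
      forall S : {set 'I_n}, start A S <-> #|S| = k
    & forall S T : {set 'I_n}, #|S| = k ->
        (step A S T <-> swap S T /\ f S + theta < f T)].

(* Main.v *)
Require Import Defs.
From mathcomp Require Import ring lra complex spectral sesquilinear perm fingroup.
Import Order.TTheory GRing.Theory Num.Theory.
Local Open Scope ring_scope.

Set Implicit Arguments.
Unset Strict Implicit.
Unset Printing Implicit Defensive.

(** The set function [f S = log vol (X_S / sigma_n)] is zero on the empty set,
    monotone and submodular, and the bound is a property of all such functions.

    Adding a column [x_j] to [X_S] multiplies the volume by the distance from
    [x_j] to the column space of [X_S], that is, by the minimum of [|X v|] over
    the vectors [v] supported on [j |: S] with [v_j = 1] ([vol_insert]).  A larger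
    [S] allows more vectors [v], so the factor decreases: [log vol] is submodular
    ([vol_submodular]).  Every such [v] has [|v| >= 1], and [|X v| >= sigma_n |v|]
    by the spectral theorem ([sigma_min]), so the factor is at least [sigma_n]:
    dividing [X] by [sigma_n] makes [log vol] monotone ([vol_growth]).  The same
    induction shows that all column subsets have positive volume.

    Let now [f] be monotone, submodular and nonnegative, and let no interchange
    improve [f S] by more than [theta].  For each [i] in [S :\: T], submodularity
    bounds the gain from [S :\ i] to [(S :\ i) :|: (T :\: S)], a superset of [T], by
    the sum of the gains of the single elements of [T :\: S], and each of these is
    at most [theta + (f S - f (S :\ i))].  Summing over [i], and using that the
    losses [f S - f (S :\ i)] add up to at most [f S], gives
    [k (f T - f S) <= (k - 1) f S + k^2 theta], which is the claimed bound on
    [f T - f S] ([interchange_gap]).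

    Normalizing by [sigma_n] shifts [log vol] by the same constant on all sets of
    [k] columns.  It changes neither the gap nor the admissible interchanges, and
    [f T] at an optimal [T] is the log-volume that appears in the bound. *)

(** * Interchange-optimal sets of monotone submodular functions *)

Definition monotone (R : realFieldType) (I : finType) (f : {set I} -> R) :=
  forall (A : {set I}) j, j \notin A -> f A <= f (j |: A).

Definition submodular (R : realFieldType) (I : finType) (f : {set I} -> R) :=
  forall (A B : {set I}) j, A \subset B -> j \notin B ->
    f (j |: B) - f B <= f (j |: A) - f A.

Lemma monotone_subset (R : realFieldType) (I : finType) (f : {set I} -> R)
    (A B : {set I}) : monotone f -> A \subset B -> f A <= f B.
Proof.
move=> fmono; have [N] := ubnP #|B :\: A|; elim: N A => // N IHN A ltN sAB.
have [/eqP|[j]] := set_0Vmem (B :\: A).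
  rewrite setD_eq0 => sBA; rewrite (_ : A = B) //.
  by apply/eqP; rewrite eqEsubset sAB.
move=> jBA; have := jBA; rewrite inE => /andP[jNA jB].
apply: le_trans (fmono _ _ jNA) (IHN _ _ _); last by rewrite subUset sub1set jB.
have -> : B :\: (j |: A) = (B :\: A) :\ j.
  by apply/setP=> x; rewrite !inE negb_or andbA.
by move: ltN; rewrite (cardsD1 j) jBA.
Qed.

(** Adding the elements of [U] one at a time, each gain is at most the gain over
    the smaller set [A]. *)
Lemma submodular_union_le (R : realFieldType) (I : finType) (f : {set I} -> R)
    (A U : {set I}) : submodular f -> [disjoint A & U] ->
  f (A :|: U) - f A <= \sum_(j in U) (f (j |: A) - f A).
Proof.
move=> fsub; have [N] := ubnP #|U|; elim: N U => // N IHN U ltN dAU.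
have [->|[j jU]] := set_0Vmem U; first by rewrite setU0 subrr big_set0.
have jNA : j \notin A by rewrite (disjointFl dAU).
rewrite (big_setD1 _ jU) /=.
have dAUj : [disjoint A & U :\ j] by apply: disjointWr dAU; rewrite subsetDl.
have ltUj : (#|U :\ j| < N)%N by move: ltN; rewrite (cardsD1 j) jU.
have := IHN _ ltUj dAUj.
have := fsub A (A :|: (U :\ j)) j (subsetUl _ _).
rewrite !inE eqxx /= orbF => /(_ jNA).
rewrite setUCA setD1K //; lra.
Qed.

(** Removing the elements of [U] one at a time, each loss is at least the loss
    from the larger set [A]. *)
Lemma submodular_removal_le (R : realFieldType) (I : finType)
    (f : {set I} -> R) (A U : {set I}) : submodular f -> U \subset A ->
  \sum_(i in U) (f A - f (A :\ i)) <= f A - f (A :\: U).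
Proof.
move=> fsub; have [N] := ubnP #|U|; elim: N U => // N IHN U ltN sUA.
have [->|[j jU]] := set_0Vmem U; first by rewrite setD0 subrr big_set0.
rewrite (big_setD1 _ jU) /=.
have ltUj : (#|U :\ j| < N)%N by move: ltN; rewrite (cardsD1 j) jU.
have := IHN _ ltUj (subset_trans (subsetDl _ _) sUA).
have jA : j \in A := subsetP sUA _ jU.
have sDj : A :\: U \subset A :\ j by rewrite setDS // sub1set.
have := fsub _ _ j sDj; rewrite !inE eqxx => /(_ isT).
rewrite setD1K //.
have -> : j |: (A :\: U) = A :\: (U :\ j).
  by apply/setP=> x; rewrite !inE; case: eqP => [->|]//=; rewrite jA.
lra.
Qed.

(** Averaging over all pairs in [S :\: T] and [T :\: S], rather than matching the
    two sets by a bijection, is what gives [(k - 1) / (2 * k - 1)] instead of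
    [1 / 2].  With [r = #|T :\: S|] the average reads
    [f T - f S <= r * theta + (1 - 1 / r) * D], where the total loss [D] is at
    most [f S]; it only weakens when [r] grows to [k]. *)
Lemma interchange_gap (R : realFieldType) (I : finType) (f : {set I} -> R)
    (k : nat) (theta : R) (S T : {set I}) :
  monotone f -> submodular f -> 0 <= f set0 -> 0 <= theta -> (0 < k)%N ->
  #|S| = k -> #|T| = k ->
  (forall i j, i \in S -> j \notin S -> f (j |: (S :\ i)) <= f S + theta) ->
  f T - f S <=
    (k%:R - 1) / (2 * k%:R - 1) * f T + k%:R ^+ 2 / (2 * k%:R - 1) * theta.
Proof.
move=> fmono fsub f0 theta0 k0 cS cT locopt.
set r := #|T :\: S|.
have cST : #|S :\: T| = r by rewrite /r !cardsD cS cT setIC.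
have le_rk : (r <= k)%N by rewrite -cT subset_leq_card // subsetDl.
set D := \sum_(i in S :\: T) (f S - f (S :\ i)).
have fge0 A : 0 <= f A by apply: le_trans f0 (monotone_subset fmono (sub0set A)).
have D0 : 0 <= D.
  by apply: sumr_ge0 => i _; rewrite subr_ge0 monotone_subset // subsetDl.
have DfS : D <= f S.
  apply: le_trans (submodular_removal_le fsub (subsetDl S T)) _.
  by rewrite lerBlDr lerDl.
have step i : i \in S :\: T ->
    f T - f S + (f S - f (S :\ i)) <= r%:R * theta + r%:R * (f S - f (S :\ i)).
  rewrite inE => /andP[iNT iS].
  have dis : [disjoint S :\ i & T :\: S].
    rewrite -setI_eq0; apply/eqP/setP => x; rewrite !inE.
    by case: (x \in S); rewrite ?andbF.
  have sT : T \subset (S :\ i) :|: (T :\: S).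
    apply/subsetP => x xT; rewrite !inE xT andbT.
    by case: eqP => [xi|_]; [rewrite -xi xT in iNT | case: (x \in S)].
  have := submodular_union_le fsub dis; have := monotone_subset fmono sT.
  have : \sum_(j in T :\: S) (f (j |: (S :\ i)) - f (S :\ i)) <=
         \sum_(j in T :\: S) (theta + (f S - f (S :\ i))).
    apply: ler_sum => j; rewrite inE => /andP[jNS _].
    by have := locopt _ _ iS jNS; lra.
  rewrite sumr_const -/r => h1 h2 h3.
  apply: le_trans (_ : f ((S :\ i) :|: (T :\: S)) - f (S :\ i) <= _).
    by rewrite addrA subrK lerD2r.
  by apply: le_trans h3 _; apply: le_trans h1 _; rewrite -mulrDr mulr_natl.
have sum_step : r%:R * (f T - f S) + D <= r%:R * (r%:R * theta) + r%:R * D.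
  have := ler_sum (index_enum I) step.
  rewrite big_split [X in _ <= X]big_split /= !sumr_const cST -mulr_sumr -/D.
  by rewrite -[(f T - _) *+ r]mulr_natl -[(_ * theta) *+ r]mulr_natl.
have k1 : 1 <= k%:R :> R by rewrite ler1n.
have rk : r%:R <= k%:R :> R by rewrite ler_nat.
set g := f T - f S in sum_step *.
have gap : k%:R * g <= k%:R ^+ 2 * theta + (k%:R - 1) * f S.
  (* If [r = 0] then [S = T], so there is nothing to average over. *)
  have [r0|r0] := posnP r.
    have -> : g = 0.
      apply/eqP; rewrite subr_eq0; apply/eqP; congr (f _); apply/eqP.
      by rewrite eqEcard cS cT leqnn andbT -setD_eq0 -cards_eq0 -/r r0.
    by rewrite mulr0 addr_ge0 ?mulr_ge0 ?exprn_ge0 ?subr_ge0.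
  have r1 : 1 <= r%:R :> R by rewrite ler1n.
  apply: le_trans (_ : k%:R ^+ 2 * theta + (k%:R - 1) * D <= _); last first.
    by rewrite lerD2l ler_wpM2l ?subr_ge0.
  (* [sum_step] times [k]; the two slacks come from replacing [r] by [k]. *)
  rewrite -(ler_pM2l (_ : 0 < r%:R)); last by lra.
  have h1 : r%:R * (k%:R - r%:R) * theta * k%:R >= 0.
    by rewrite !mulr_ge0 ?subr_ge0.
  have h2 : 0 <= (k%:R - r%:R) * D by rewrite mulr_ge0 ?subr_ge0.
  have h3 : k%:R * (r%:R * g + D) <= k%:R * (r%:R * (r%:R * theta) + r%:R * D).
    by rewrite ler_wpM2l.
  lra.
have d0 : 0 < 2 * k%:R - 1 :> R by lra.
rewrite mulrAC [_ / _ * theta]mulrAC -mulrDl ler_pdivlMr //.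
rewrite /g in gap *; lra.
Qed.

(** * Spectral theorem and the smallest singular value *)

Definition normsq (R : pzRingType) (m : nat) (v : 'cV[R]_m) : R :=
  (v^T *m v) 0 0.

Lemma normsqE (R : pzRingType) (m : nat) (v : 'cV[R]_m) :
  normsq v = \sum_i v i 0 * v i 0.
Proof. by rewrite /normsq mxE; apply: eq_bigr => i _; rewrite mxE. Qed.

Lemma normsq_ge0 (R : realDomainType) (m : nat) (v : 'cV[R]_m) : 0 <= normsq v.
Proof. by rewrite normsqE sumr_ge0 // => i _; rewrite -expr2 sqr_ge0. Qed.

Lemma normsq_ge_entry (R : realDomainType) (m : nat) (v : 'cV[R]_m) i :
  v i 0 ^+ 2 <= normsq v.
Proof.
rewrite normsqE (bigD1 i) //= expr2 lerDl.
by apply: sumr_ge0 => j _; rewrite -expr2 sqr_ge0.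
Qed.

Lemma normsq_gt0 (R : realDomainType) (m : nat) (v : 'cV[R]_m) :
  v != 0 -> 0 < normsq v.
Proof.
case/cV0Pn => i vi; apply: lt_le_trans (normsq_ge_entry v i).
by rewrite lt_def sqrf_eq0 vi sqr_ge0.
Qed.

Lemma char_poly_unitary_diag (C : numClosedFieldType) (n : nat) (P : 'M[C]_n)
    (d : 'rV[C]_n) : P \in unitmx ->
  char_poly (invmx P *m diag_mx d *m P) = \prod_i ('X - (d 0 i)%:P).
Proof.
move=> Pu.
have -> : \prod_i ('X - (d 0 i)%:P) = char_poly (diag_mx d).
  rewrite char_poly_trig.
    by apply: eq_bigr => i _; rewrite mxE eqxx mulr1n.
  apply/is_trig_mxP => i j ij; rewrite mxE; case: eqP => // e.
  by rewrite e ltnn in ij.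
rewrite /char_poly /char_poly_mx.
set Q := map_mx (@polyC C) P.
have Qu : Q \in unitmx by rewrite map_unitmx.
have -> : 'X%:M - map_mx polyC (invmx P *m diag_mx d *m P) =
    invmx Q *m ('X%:M - map_mx polyC (diag_mx d)) *m Q.
  rewrite mulmxBr mulmxBl; congr (_ - _); last by rewrite !map_mxM map_invmx.
  by rewrite scalar_mxC -mulmxA mulVmx // mulmx1.
by rewrite !det_mulmx mulrC mulrA -det_mulmx mulmxV // det1 mul1r.
Qed.

(** A real symmetric matrix is Hermitian over [R[i]], where it is unitarily
    diagonalizable with real diagonal [d].  The characteristic polynomial descends
    to [R], and in the coordinates [w = P v] both sides of the quadratic-form bound
    become sums of [|w_i|^2], with the weights [a] and [d_i]. *)
Lemma symmetric_spectral (R : rcfType) (n : nat) (A : 'M[R]_n) : A^T = A ->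
  exists d : 'rV[R]_n,
    char_poly A = \prod_i ('X - (d 0 i)%:P) /\
    forall a, (forall i, a <= d 0 i) ->
      forall v : 'cV_n, a * normsq v <= (v^T *m A *m v) 0 0.
Proof.
move=> symA.
pose toC := real_complex R.
pose B : 'M[R[i]]_n := map_mx toC A.
have realB p q (M : 'M[R]_(p, q)) : map_mx toC M \is a mxOver Num.real.
  by apply/mxOverP => i j; rewrite mxE complex_real.
have hB : B \is hermsymmx.
  apply: realsym_hermsym (realB _ _ _).
  apply/is_hermitianmxP; rewrite expr0 scale1r map_mx_id //.
  by rewrite /B map_trmx symA.
have Pun := spectral_unitarymx B; have Pu := spectral_unit B.
have Dreal := hermitian_spectral_diag_real hB.
have /orthomx_spectralP := hermitian_normalmx hB.
set P := spectralmx B in Pun Pu *; set D := spectral_diag B in Dreal * => BE.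
exists (map_mx (@complex.Re R) D).
have DE i : (complex.Re (D 0 i))%:C%C = D 0 i by apply: RRe_real; apply/mxOverP.
split.
  apply: (map_poly_inj (real_complex R)).
  rewrite map_char_poly -/B BE char_poly_unitary_diag // rmorph_prod.
  apply: eq_bigr => i _.
  by rewrite rmorphB /= map_polyX map_polyC /= mxE DE.
move=> a aD v.
pose w := P *m map_mx toC v.
have vC : (map_mx toC v)^T = map_mx Num.conj (map_mx toC v)^T.
  by rewrite map_trmx realmxC // realB.
have wE : map_mx Num.conj w^T = map_mx toC v^T *m invmx P.
  by rewrite trmx_mul map_mxM -vC invmx_unitary // map_trmx.
have nE : (normsq v)%:C%C = \sum_i `|w i 0| ^+ 2.
  have -> : (normsq v)%:C%C = (map_mx toC (v^T *m v)) 0 0 by rewrite mxE.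
  rewrite map_mxM -[X in _ *m X]mul1mx -(mulVmx Pu) -mulmxA mulmxA -wE -/w.
  by rewrite mxE; apply: eq_bigr => i _; rewrite !mxE mulrC normCK.
have qE : ((v^T *m A *m v) 0 0)%:C%C = \sum_i D 0 i * `|w i 0| ^+ 2.
  have -> : ((v^T *m A *m v) 0 0)%:C%C = (map_mx toC (v^T *m A *m v)) 0 0.
    by rewrite [RHS]mxE.
  rewrite !map_mxM -/B BE !mulmxA -wE -mulmxA -/w.
  rewrite mxE; apply: eq_bigr => i _.
  rewrite mul_mx_diag !mxE normCK.
  by ring.
rewrite -lecR rmorphM /= nE qE mulr_sumr.
apply: ler_sum => i _; rewrite ler_wpM2r ?exprn_ge0 //.
by have := aD i; rewrite mxE -lecR DE.
Qed.

Lemma eigenvalues_perm_eq (R : rcfType) (n : nat) (A : 'M[R]_n) (d : 'rV[R]_n) :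
  char_poly A = \prod_i ('X - (d 0 i)%:P) ->
  perm_eq (eigenvalues A) [seq d 0 i | i <- enum 'I_n].
Proof.
move=> pE.
have p0 : char_poly A != 0 by apply: monic_neq0 (char_poly_monic A).
have pE' : char_poly A = \prod_(a <- [seq d 0 i | i <- enum 'I_n]) ('X - a%:P).
  by rewrite big_map big_enum.
apply/allP => x _ /=; apply/eqP; rewrite /eigenvalues.
rewrite -(mu_prod_XsubC x [seq d 0 i | i <- _]) -pE'.
rewrite count_flatten -map_comp.
pose mult a := ((x == a) * mup x (char_poly A))%N.
rewrite (@eq_map _ _ _ mult); last first.
  move=> a; rewrite /mult /= count_nseq /= eq_sym.
  by case: eqP => [->|].
have [rx|nrx] := boolP (root (char_poly A) x).
  have xr : x \in rootsR (char_poly A).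
    by have /(_ x) := roots_on_rootsR p0; rewrite !inE rx.
  rewrite sumnE big_map /mult (bigD1_seq x) ?uniq_roots //= eqxx mul1n big1 ?addn0 //.
  by move=> a; rewrite eq_sym => /negPf ->.
by rewrite sumnE big_map /mult mupNroot // big1 // => a _; rewrite muln0.
Qed.

(** The square of the last singular value is the least eigenvalue of [X^T *m X],
    which is positive because [X] is injective.  The existence of [n] real
    eigenvalues matters: with fewer, [sigma X n] would be the default value [0]. *)
Lemma sigma_min (R : rcfType) (m n : nat) (X : 'M[R]_(m, n)) :
  \rank X = n -> (0 < n)%N ->
  0 < sigma X n /\
  forall v : 'cV_n, sigma X n ^+ 2 * normsq v <= normsq (X *m v).
Proof.
move=> rX n0.
have Xinj (v : 'cV_n) : X *m v = 0 -> v = 0.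
  move=> Xv; apply: trmx_inj; rewrite trmx0.
  apply/eqP; rewrite -(mulmx_free_eq0 _ (_ : row_free X^T)).
    by rewrite -trmx_mul Xv trmx0.
  by rewrite /row_free mxrank_tr rX.
have XE (v : 'cV_n) : normsq (X *m v) = (v^T *m (X^T *m X) *m v) 0 0.
  by rewrite /normsq trmx_mul !mulmxA.
have [|d [dE dmin]] := @symmetric_spectral R n (X^T *m X).
  by rewrite trmx_mul trmxK.
have eE := eigenvalues_perm_eq dE.
have dpos i : 0 < d 0 i.
  have : eigenvalue (X^T *m X) (d 0 i).
    rewrite eigenvalue_root_char dE /root horner_prod (bigD1 i) //=.
    by rewrite hornerXsubC subrr mul0r.
  case/eigenvalueP => v vE v0.
  have : normsq (X *m v^T) = d 0 i * normsq v^T.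
    by rewrite XE trmxK vE -scalemxAl mxE /normsq trmxK.
  have vT0 : v^T != 0 by rewrite -(inj_eq trmx_inj) trmxK trmx0.
  have Xv0 : X *m v^T != 0 by apply: contra_neq vT0 => /Xinj.
  by move=> h; have := normsq_gt0 Xv0; rewrite h pmulr_lgt0 // normsq_gt0.
set s := singular_values X.
have sE : perm_eq s [seq Num.sqrt (d 0 i) | i <- enum 'I_n].
  rewrite /s /singular_values perm_sort.
  by rewrite [X in perm_eq _ X](map_comp Num.sqrt (fun i => d 0 i)) perm_map.
have size_s : size s = n by rewrite (perm_size sE) size_map size_enum_ord.
have sin : sigma X n \in s by rewrite mem_nth // size_s prednK.
have smin x : x \in s -> sigma X n <= x.
  move=> /(nthP 0)[j]; rewrite size_s => ltin <-.
  have ss : sorted (fun x y : R => y <= x) s.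
    by apply: sort_sorted => y z; rewrite le_total.
  apply: (sorted_leq_nth _ _ _ ss); rewrite ?inE ?size_s ?prednK //.
  - by move=> a b c ab bc; apply: le_trans bc ab.
  - by rewrite -ltnS prednK.
split.
  by move: sin; rewrite (perm_mem sE) => /mapP[i _ ->]; rewrite sqrtr_gt0.
move=> v; rewrite XE; apply: dmin => i.
rewrite -[d 0 i](sqr_sqrtr (ltW (dpos i))) lerXn2r // ?nnegrE ?sqrtr_ge0 //.
  by move: sin; rewrite (perm_mem sE) => /mapP[j _ ->]; rewrite sqrtr_ge0.
apply: smin; rewrite (perm_mem sE); apply/mapP.
by exists i; rewrite ?mem_enum.
Qed.

(** * Volume and insertion of a column *)

Lemma normsqD_orthogonal (R : comPzRingType) (m : nat) (u v : 'cV[R]_m) :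
  u^T *m v = 0 -> normsq (u + v) = normsq u + normsq v.
Proof.
move=> uv0; have vu0 : v^T *m u = 0.
  by apply: trmx_inj; rewrite trmx_mul trmxK uv0 trmx0.
by rewrite /normsq [(u + v)^T]raddfD /= mulmxDl !mulmxDr uv0 vu0 addr0 add0r mxE.
Qed.

(** The column operation that removes [B *m c] from the last column is unimodular
    and leaves a block-diagonal Gram matrix. *)
Lemma vol_row_mx (R : rcfType) (m p : nat) (B : 'M[R]_(m, p)) (r : 'cV_m)
    (c : 'cV_p) : B^T *m r = 0 ->
  vol (row_mx B (r + B *m c)) = vol B * Num.sqrt (normsq r).
Proof.
move=> Br.
have -> : row_mx B (r + B *m c) = row_mx B r *m block_mx 1%:M c 0 1%:M.
  by rewrite mul_row_block !mulmx1 mulmx0 addr0 addrC.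
rewrite /vol [_ * Num.sqrt _]mulrC -sqrtrM ?normsq_ge0 //; congr Num.sqrt.
have rB : r^T *m B = 0 by apply: trmx_inj; rewrite trmx_mul trmxK Br trmx0.
rewrite trmx_mul mulmxA -[_ *m _ *m row_mx B r]mulmxA tr_row_mx mul_col_row.
rewrite Br rB.
rewrite !det_mulmx det_tr det_ublock !det1 det_lblock !mul1r mulr1 mulrC.
by congr (_ * _); rewrite det_mx11.
Qed.

Lemma gram_unitmx (R : rcfType) (m p : nat) (B : 'M[R]_(m, p)) :
  vol B != 0 -> B^T *m B \in unitmx.
Proof.
rewrite unitmxE unitfE; apply: contra_neq => detB.
by rewrite /vol detB sqrtr0.
Qed.

Lemma orthogonal_residual (R : rcfType) (m p : nat) (B : 'M[R]_(m, p))
    (x : 'cV_m) : vol B != 0 -> exists c, B^T *m (x - B *m c) = 0.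
Proof.
move=> /gram_unitmx Bu.
exists (invmx (B^T *m B) *m (B^T *m x)).
by rewrite mulmxBr [B^T *m (B *m _)]mulmxA mulKVmx // subrr.
Qed.

(** Two enumerations of the same columns differ by a permutation, whose
    determinant is squared in the Gram determinant. *)
Lemma vol_colsub_codom (R : rcfType) (m n p q : nat) (X : 'M[R]_(m, n))
    (f : 'I_p -> 'I_n) (g : 'I_q -> 'I_n) :
  injective f -> injective g -> codom f =i codom g ->
  vol (colsub f X) = vol (colsub g X).
Proof.
move=> finj ginj fg.
have pq : p = q.
  rewrite -(card_ord p) -(card_ord q) -(card_codom finj) -(card_codom ginj).
  exact: eq_card fg.
subst q.
have : perm_eq (codom f) [tuple g i | i < p].
  apply: uniq_perm => [||x]; rewrite ?fg //; first exact/injectiveP.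
  by rewrite map_inj_uniq // enum_uniq.
case/tuple_permP => s fE.
have fs i : f i = g (s i).
  have := congr1 (fun t => nth (f i) t i) fE.
  rewrite codomE /= (nth_map i) ?size_enum_ord // nth_ord_enum => ->.
  by rewrite (nth_map i) ?size_enum_ord // nth_ord_enum tnth_mktuple.
have -> : colsub f X = colsub g X *m perm_mx s^-1.
  by rewrite -col_permE; apply/matrixP => i j; rewrite !mxE fs.
rewrite /vol trmx_mul mulmxA -[_ *m _ *m colsub g X]mulmxA !det_mulmx det_tr.
by rewrite det_perm mulrAC -expr2 sqrr_sign mul1r.
Qed.

(** Inserting [j] into the increasing enumeration of [S] may put it anywhere; the
    volume allows it to be moved last. *)
Lemma vol_columnsU1 (R : rcfType) (m n : nat) (X : 'M[R]_(m, n))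
    (S : {set 'I_n}) (j : 'I_n) : j \notin S ->
  vol (columns X (j |: S)) = vol (row_mx (columns X S) (col j X)).
Proof.
move=> jS.
pose g (i : 'I_(#|S| + 1)) := if split i is inl a then enum_val a else j.
have -> : row_mx (columns X S) (col j X) = colsub g X.
  by apply/matrixP => a b; rewrite !mxE /g; case: split => c; rewrite mxE.
apply: vol_colsub_codom.
- exact: enum_val_inj.
- move=> a b; rewrite /g.
  case: (splitP a) => a' aE; case: (splitP b) => b' bE.
  + by move/enum_val_inj => ab; apply: val_inj; rewrite /= aE bE ab.
  + by move=> e; case/negP: jS; rewrite -e enum_valP.
  + by move=> e; case/negP: jS; rewrite e enum_valP.
  + by move=> _; apply: val_inj; rewrite /= aE bE !ord1.
move=> x; apply/codomP/codomP => -[a ->].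
  have := enum_valP a; rewrite in_setU1 => /orP[/eqP ->|aS].
    by exists (rshift _ 0); rewrite /g (unsplitK (inr 0)).
  exists (lshift _ (enum_rank_in aS (enum_val a))).
  by rewrite /g (unsplitK (inl _)) enum_rankK_in.
have jU : j \in j |: S by rewrite setU11.
have gU : g a \in j |: S.
  by rewrite /g; case: split => c //; rewrite in_setU1 enum_valP orbT.
by exists (enum_rank_in jU (g a)); rewrite enum_rankK_in.
Qed.

(** For these [v], [X *m v] ranges over [x_j] plus the column space of [X_S]. *)
Definition unit_combination (R : pzRingType) (n : nat) (S : {set 'I_n})
    (j : 'I_n) (v : 'cV[R]_n) : Prop :=
  v j 0 = 1 /\ forall i, i \notin j |: S -> v i 0 = 0.

Lemma unit_combinationS (R : pzRingType) (n : nat) (S T : {set 'I_n}) (j : 'I_n)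
    (v : 'cV[R]_n) :
  S \subset T -> unit_combination S j v -> unit_combination T j v.
Proof.
move=> sST [vj v0]; split=> // i iT; apply: v0.
by apply: contra iT; apply/subsetP/setUS.
Qed.

(** Base times height.  The height is described as a minimum of [normsq (X *m v)],
    with [v] in ['cV_n] for every [S], so that heights over different sets can be
    compared. *)
Lemma vol_insert (R : rcfType) (m n : nat) (X : 'M[R]_(m, n))
    (S : {set 'I_n}) (j : 'I_n) : j \notin S -> vol (columns X S) != 0 ->
  exists v : 'cV_n, [/\ unit_combination S j v,
    vol (columns X (j |: S)) = vol (columns X S) * Num.sqrt (normsq (X *m v))
    & forall w, unit_combination S j w -> normsq (X *m v) <= normsq (X *m w)].
Proof.
move=> jS volS; rewrite vol_columnsU1 //.
(* [E] embeds coefficient vectors indexed by [S] into ['cV_n]. *)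
pose E : 'M[R]_(n, #|S|) := colsub enum_val 1%:M.
have BE : columns X S = X *m E by rewrite mulmx_colsub mulmx1.
set B := columns X S in volS BE *.
have EE (c : 'cV_#|S|) i : (E *m c) i 0 = \sum_a (i == enum_val a)%:R * c a 0.
  by rewrite mxE; apply: eq_bigr => a _; rewrite !mxE.
have E0 (c : 'cV_#|S|) i : i \notin S -> (E *m c) i 0 = 0.
  move=> iS; rewrite EE big1 // => a _; case: eqP => [e|]; last by rewrite mul0r.
  by case/negP: iS; rewrite e enum_valP.
have colE : col j X = X *m delta_mx j 0 by rewrite colE.
have [c cE] := orthogonal_residual (col j X) volS.
set r := col j X - B *m c in cE *.
have vE : X *m (delta_mx j 0 - E *m c) = r by rewrite mulmxBr -colE mulmxA -BE.
have vi i : (delta_mx j 0 - E *m c) i 0 = (i == j)%:R - (E *m c) i 0.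
  by rewrite mxE [delta_mx _ _ _ _]mxE [(- (E *m c)) i 0]mxE eqxx andbT.
exists (delta_mx j 0 - E *m c); rewrite vE; split.
- split=> [|i]; first by rewrite vi E0 // eqxx subr0.
  by rewrite in_setU1 negb_or vi => /andP[/negPf -> iS]; rewrite E0 // subr0.
- by rewrite -(vol_row_mx c) // subrK.
move=> w [wj w0].
have -> : X *m w = r + B *m (c + rowsub enum_val w).
  rewrite mulmxDr addrA subrK BE -mulmxA colE -mulmxDr; congr (_ *m _).
  apply/matrixP => i z; rewrite ord1 mxE EE mxE eqxx andbT.
  have [iS|iS] := boolP (i \in S).
    rewrite (bigD1 (enum_rank_in iS i)) //= enum_rankK_in // eqxx mul1r mxE.
    rewrite enum_rankK_in // big1 ?addr0; last first.
      move=> a /eqP ai; case: eqP => [e|]; last by rewrite mul0r.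
      by case: ai; apply: enum_val_inj; rewrite enum_rankK_in.
    by case: eqP jS => [<-|]; rewrite ?iS ?add0r.
  rewrite big1 ?addr0; last first.
    move=> a _; case: eqP => [e|]; last by rewrite mul0r.
    by case/negP: iS; rewrite e enum_valP.
  case: eqP => [->|/eqP ij]; first by rewrite wj.
  by rewrite w0 // in_setU1 negb_or ij.
rewrite [normsq (r + _)]normsqD_orthogonal ?lerDl ?normsq_ge0 //.
by apply: trmx_inj; rewrite !trmx_mul trmxK -mulmxA cE mulmx0 trmx0.
Qed.

Lemma vol_columns0 (R : rcfType) (m n : nat) (X : 'M[R]_(m, n)) :
  vol (columns X set0) = 1.
Proof.
have : #|@set0 'I_n| = 0%N by rewrite cards0.
rewrite /vol; move: (columns X set0); move: #|_| => p B p0.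
by subst p; rewrite det_mx00 sqrtr1.
Qed.

Lemma volZ (R : rcfType) (m p : nat) (a : R) (B : 'M[R]_(m, p)) : 0 <= a ->
  vol (a *: B) = a ^+ p * vol B.
Proof.
move=> a0; rewrite /vol [(a *: B)^T]linearZ /= -scalemxAl -scalemxAr scalerA detZ.
rewrite sqrtrM ?exprn_ge0 ?mulr_ge0 // -expr2 exprAC sqrtr_sqr.
by rewrite ger0_norm ?exprn_ge0.
Qed.

(** * Growth and submodularity of the volume *)

(** The inserted height is [|X v|] for some [v] with [v_j = 1], hence [|v| >= 1]. *)
Lemma vol_growth (R : rcfType) (m n : nat) (X : 'M[R]_(m, n))
    (S : {set 'I_n}) (j : 'I_n) :
  \rank X = n -> j \notin S -> 0 < vol (columns X S) ->
  sigma X n * vol (columns X S) <= vol (columns X (j |: S)).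
Proof.
move=> rX jS vS.
have [s0 smin] := sigma_min rX (leq_ltn_trans (leq0n j) (ltn_ord j)).
have [v [[vj _] -> _]] := vol_insert jS (lt0r_neq0 vS).
rewrite mulrC ler_pM2l // -[sigma X n](ger0_norm (ltW s0)) -sqrtr_sqr.
rewrite ler_wsqrtr //; apply: le_trans (smin v).
by rewrite ler_peMr ?sqr_ge0 // -[1](expr1n _ 2) -vj normsq_ge_entry.
Qed.

Lemma vol_columns_gt0 (R : rcfType) (m n : nat) (X : 'M[R]_(m, n))
    (S : {set 'I_n}) : \rank X = n -> 0 < vol (columns X S).
Proof.
move=> rX; have [N] := ubnP #|S|; elim: N S => // N IHN S ltN.
have [->|[j jS]] := set_0Vmem S; first by rewrite vol_columns0.
have ltSj : (#|S :\ j| < N)%N by move: ltN; rewrite (cardsD1 j) jS.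
have v0 := IHN _ ltSj; rewrite -(setD1K jS).
apply: lt_le_trans (vol_growth rX _ v0); last by rewrite !inE eqxx.
have [s0 _] := sigma_min rX (leq_ltn_trans (leq0n j) (ltn_ord j)).
by rewrite mulr_gt0.
Qed.

(** The minimizer for [S] is also admissible for the larger set [T], so the height
    of [x_j] over [X_T] is at most its height over [X_S]. *)
Lemma vol_submodular (R : rcfType) (m n : nat) (X : 'M[R]_(m, n))
    (S T : {set 'I_n}) (j : 'I_n) :
  \rank X = n -> S \subset T -> j \notin T ->
  vol (columns X (j |: T)) * vol (columns X S) <=
  vol (columns X (j |: S)) * vol (columns X T).
Proof.
move=> rX sST jT; have jS : j \notin S := contra (subsetP sST j) jT.
have vS := vol_columns_gt0 S rX; have vT := vol_columns_gt0 T rX.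
have [v [vc -> _]] := vol_insert jS (lt0r_neq0 vS).
have [w [_ -> wmin]] := vol_insert jT (lt0r_neq0 vT).
rewrite mulrAC [X in _ <= X]mulrAC.
rewrite [vol (columns X S) * _]mulrC ler_pM2l; last by rewrite mulr_gt0.
by rewrite ler_wsqrtr // wmin //; apply: unit_combinationS vc.
Qed.

(** The log-volume of [X_S / sigma_n(X)]. *)
Definition normalized_log_vol (R : realType) (m n : nat) (X : 'M[R]_(m, n))
    (S : {set 'I_n}) : R :=
  log_vol (columns X S) - ln (sigma X n) *+ #|S|.

(** [#|S|] occurs in the type of [columns X S], so it cannot be rewritten in place;
    this form isolates the other occurrence. *)
Lemma normalized_log_volE (R : realType) (m n k : nat) (X : 'M[R]_(m, n))
    (S : {set 'I_n}) : #|S| = k ->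
  normalized_log_vol X S = log_vol (columns X S) - ln (sigma X n) *+ k.
Proof. by move=> <-. Qed.

Lemma normalized_log_volU1 (R : realType) (m n : nat) (X : 'M[R]_(m, n))
    (S : {set 'I_n}) (j : 'I_n) : j \notin S ->
  normalized_log_vol X (j |: S) =
  log_vol (columns X (j |: S)) - ln (sigma X n) *+ #|S|.+1.
Proof. by move=> jS; apply: normalized_log_volE; rewrite cardsU1 jS. Qed.

Lemma normalized_log_vol_monotone (R : realType) (m n : nat)
    (X : 'M[R]_(m, n)) : \rank X = n -> monotone (normalized_log_vol X).
Proof.
move=> rX A j jA.
rewrite normalized_log_volU1 // /normalized_log_vol mulrSr.
have vA := vol_columns_gt0 A rX; have vjA := vol_columns_gt0 (j |: A) rX.
have [s0 _] := sigma_min rX (leq_ltn_trans (leq0n j) (ltn_ord j)).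
have : ln (sigma X n * vol (columns X A)) <= ln (vol (columns X (j |: A))).
  by rewrite ler_ln ?posrE ?mulr_gt0 // vol_growth.
rewrite lnM ?posrE // /log_vol; lra.
Qed.

Lemma normalized_log_vol_submodular (R : realType) (m n : nat)
    (X : 'M[R]_(m, n)) : \rank X = n -> submodular (normalized_log_vol X).
Proof.
move=> rX A B j sAB jB; have jA : j \notin A := contra (subsetP sAB j) jB.
have v0 S := vol_columns_gt0 S rX.
rewrite !normalized_log_volU1 // /normalized_log_vol !mulrSr.
have : ln (vol (columns X (j |: B)) * vol (columns X A)) <=
       ln (vol (columns X (j |: A)) * vol (columns X B)).
  by rewrite ler_ln ?posrE ?mulr_gt0 // vol_submodular.
rewrite !lnM ?posrE // /log_vol; lra.
Qed.

Lemma is_columns_log_vol (R : realType) (m n k : nat) (X : 'M[R]_(m, n))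
    (S : {set 'I_n}) (B : 'M[R]_(m, k)) : is_columns X S B ->
  #|S| = k /\ log_vol B = log_vol (columns X S).
Proof. by case=> e ->; subst k; rewrite castmx_id. Qed.

Lemma log_vol_rescaled (R : realType) (m n k : nat) (X : 'M[R]_(m, n))
    (S : {set 'I_n}) (B : 'M[R]_(m, k)) :
  \rank X = n -> (0 < n)%N -> is_columns X S B ->
  log_vol ((sigma X n)^-1 *: B) = normalized_log_vol X S.
Proof.
move=> rX n0 [e ->]; subst k; rewrite castmx_id.
have [s0 _] := sigma_min rX n0; have vS := vol_columns_gt0 S rX.
rewrite /log_vol volZ ?invr_ge0 ?ltW // lnM ?posrE ?exprn_gt0 ?invr_gt0 //.
by rewrite lnXn ?invr_gt0 // lnV ?posrE // mulNrn addrC.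
Qed.

Lemma rank_columns (R : rcfType) (m n : nat) (X : 'M[R]_(m, n))
    (S : {set 'I_n}) : \rank X = n -> \rank (columns X S) = #|S|.
Proof.
move=> rX; apply/eqP; rewrite eqn_leq rank_leq_col /=.
have Bu := gram_unitmx (lt0r_neq0 (vol_columns_gt0 S rX)).
by rewrite -{1}(mxrank_unit Bu) mxrankM_maxr.
Qed.

Lemma gu_eisenstat_one_interchange (R : realType) (m n k : nat)
    (X : 'M[R]_(m, n)) (eta : R) : \rank X = n -> 1 < eta ->
  is_one_interchange (gu_eisenstat X k eta)
    (fun S => log_vol (columns X S)) k (ln eta).
Proof.
move=> rX eta1; split; first by rewrite ln_ge0 // ltW.
  by move=> S; split=> [[]|cS] //; split; rewrite // rank_columns.
move=> S T _; have eta0 : 0 < eta by apply: lt_trans eta1.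
have vS := vol_columns_gt0 S rX; have vT := vol_columns_gt0 T rX.
by rewrite /= /log_vol addrC -lnM ?posrE // ltr_ln ?posrE ?mulr_gt0.
Qed.

Theorem theorem5p3 (R : realType) (m n k : nat) (X : 'M[R]_(m, n)) (eta : R)
    (Xstar : 'M[R]_(m, k))
    (hrank : \rank X = n) (hk : (0 < k < n)%N) (heta : 1 < eta)
    (hstar : max_log_vol X Xstar) :
  [/\ is_one_interchange (gu_eisenstat X k eta)
        (fun S : {set 'I_n} => log_vol (columns X S)) k (ln eta),
      forall Xk : 'M[R]_(m, k), gu_eisenstat_output X eta Xk ->
        0 <= log_vol Xstar - log_vol Xk /\
        log_vol Xstar - log_vol Xk <=
          (k%:R - 1) / (2 * k%:R - 1) * log_vol ((sigma X n)^-1 *: Xstar)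
          + k%:R ^+ 2 / (2 * k%:R - 1) * ln eta,
      (k%:R - 1) / (2 * k%:R - 1) < 1 / 2 :> R
    & k%:R ^+ 2 / (2 * k%:R - 1) <= k%:R :> R].
Proof.
case/andP: hk => k0 kn; have n0 : (0 < n)%N by apply: leq_ltn_trans kn.
have inter := gu_eisenstat_one_interchange k hrank heta.
have k1 : 1 <= k%:R :> R by rewrite ler1n.
have d0 : 0 < 2 * k%:R - 1 :> R by lra.
split=> //; last first.
- rewrite ler_pdivrMr // expr2 ler_pM2l; lra.
- rewrite ltr_pdivrMr //; lra.
move=> Xk [S [_ Sfinal] colS].
have [[T colT] Tmax] := hstar.
have [cS lS] := is_columns_log_vol colS.
have [cT lT] := is_columns_log_vol colT.
split; first by rewrite subr_ge0; apply: Tmax; exists S.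
have [theta0 _ stepP] := inter.
have f0 : 0 <= normalized_log_vol X set0.
  rewrite (normalized_log_volE _ (cards0 _)) mulr0n subr0.
  by rewrite /log_vol vol_columns0 ln1.
have locopt i j : i \in S -> j \notin S ->
    normalized_log_vol X (j |: (S :\ i)) <= normalized_log_vol X S + ln eta.
  move=> iS jS.
  have cU : #|j |: (S :\ i)| = k.
    by rewrite cardsU1 !inE (negPf jS) andbF -cS [in RHS](cardsD1 i) iS.
  rewrite (normalized_log_volE _ cS) (normalized_log_volE _ cU).
  rewrite addrAC lerD2r leNgt; apply/negP => gain.
  apply: (Sfinal (j |: (S :\ i))); apply/stepP => //; split=> //.
  by exists i, j.
have := interchange_gap (normalized_log_vol_monotone hrank)
  (normalized_log_vol_submodular hrank) f0 theta0 k0 cS cT locopt.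
rewrite (log_vol_rescaled hrank n0 colT) lS lT.
have -> : normalized_log_vol X T - normalized_log_vol X S =
    log_vol (columns X T) - log_vol (columns X S).
  by rewrite (normalized_log_volE _ cS) (normalized_log_volE _ cT); ring.
by [].
Qed.
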